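(* Let $m,n,p$ be positive integers, let $K_{m,n,p}$ be the complete 3-partite 3-uniform hypergraph with vertex classes of sizes $m,n,p$, and let $G$ be its line graph. Set $b_i=mn+np+mp-i(m+n+p-i)$. Then the number of successive orderings of the vertices of $G$ is $$\sigma(G)=\frac{(mnp-1)!\prod_{i=1}^{m+n+p-1}b_i}{\prod_{i=1}^{m-1}b_i\prod_{i=1}^{n-1}b_i\prod_{i=1}^{p-1}b_i}=(mnp)!\cdot\frac{\prod_{i=m}^{m+p}b_i}{mnp\prod_{i=1}^{p-1}b_i},$$ where the fractions are evaluated disregarding all zero factors in both numerator and denominator.
   Context: $K_{m,n,p}$ has vertex set $V_1\cup V_2\cup V_3$ (pairwise disjoint, $|V_1|=m,|V_2|=n,|V_3|=p$) and hyperedges all 3-sets meeting each $V_j$ in exactly one vertex. The line graph of a hypergraph has the hyperedges as vertices, two being adjacent iff they intersect. A linear ordering of the vertices of a graph is successive if for every $i$ the first $i$ vertices induce a connected subgraph. Empty products equal $1$. *)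

(* Defs.v *)
From HB Require Import structures.
From mathcomp Require Import all_boot all_order all_algebra.

Set Implicit Arguments.
Unset Strict Implicit.
Unset Printing Implicit Defensive.

Import Order.TTheory GRing.Theory Num.Theory.

Record sgraph := SGraph {
  vert :> finType;
  adj : rel vert;
  adj_sym : symmetric adj;
  adj_irrefl : irreflexive adj
}.

Definition induced_rel (G : sgraph) (A : {set G}) : rel G :=
  [rel x y | [&& x \in A, y \in A & adj x y]].

Definition induces_connected (G : sgraph) (A : {set G}) : bool :=
  [forall x in A, forall y in A, connect (induced_rel A) x y].

(* A linear ordering of the vertices is a duplicate-free tuple listing all of
   them. *)
Definition successive (G : sgraph) (s : #|G|.-tuple G) : bool :=
  [forall i : 'I_#|G|.+1, induces_connected [set x in take i s]].

Definition nb_successive_orderings (G : sgraph) : nat :=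
  #|[set s : #|G|.-tuple G | uniq s && successive s]|.

Section LineGraph.

Variables (V : finType) (H : {set {set V}}).

Definition hyperedge : finType := {e : {set V} | e \in H}.

Definition line_adj : rel hyperedge :=
  [rel e f | (e != f) && (val e :&: val f != set0)].

Lemma line_adj_sym : symmetric line_adj.
Proof. by move=> e f; rewrite /line_adj /= eq_sym setIC. Qed.

Lemma line_adj_irrefl : irreflexive line_adj.
Proof. by move=> e; rewrite /line_adj /= eqxx. Qed.

Definition line_graph : sgraph := SGraph line_adj_sym line_adj_irrefl.

End LineGraph.

Section CompleteTripartite.

Variables m n p : nat.

Definition K3_vertex : finType := ('I_m + 'I_n + 'I_p)%type.

Definition class1 : {set K3_vertex} := [set inl (inl i) | i : 'I_m].
Definition class2 : {set K3_vertex} := [set inl (inr j) | j : 'I_n].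
Definition class3 : {set K3_vertex} := [set inr k | k : 'I_p].

Definition K3 : {set {set K3_vertex}} :=
  [set e : {set K3_vertex} |
    [&& #|e| == 3, #|e :&: class1| == 1, #|e :&: class2| == 1
      & #|e :&: class3| == 1]].

Local Open Scope ring_scope.

Definition b (i : nat) : int :=
  m%:Z * n%:Z + n%:Z * p%:Z + m%:Z * p%:Z
    - i%:Z * (m%:Z + n%:Z + p%:Z - i%:Z).

(* The product of the nonzero b_i for lo <= i <= hi, both bounds included. *)
Definition prod_b (lo hi : nat) : rat :=
  \prod_(lo <= i < hi.+1 | b i != 0) (b i)%:~R.

End CompleteTripartite.

(* Main.v *)
(**
Call a vertex of an ordering a source if none of its neighbours precedes it.
The sources form an independent set, and the ordering is successive iff the
first vertex is the only source.  Since the alternating sum of [- |I|] over the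
subsets [I] of a finite set [B] is [1] if [|B| = 1] and [0] otherwise, it is
enough to count the orderings in which a given independent set [I] consists of
sources.  In a fully regular graph (the number [a k] of vertices outside the
closed neighbourhood of an independent [k]-set depends only on [k]) this
number is [N! k! / \prod_(1 <= i <= k) (a 0 - a i)], and there are
[\prod_(i < k) a i / k!] independent [k]-sets.

For the line graph of [K_(m,n,p)], [a i = (m - i) (n - i) (p - i)] and
[a 0 - a i = i b_i].  By symmetry one may take [p] minimal, so that no
vanishing [b_i] occurs in the second closed form.  Factoring
[b_i = (i - r1) (i - r2)] over the algebraic numbers, the alternating sum
becomes a combination of a telescoping sum and a terminating Saalschützian
3F2(1), which the Pfaff-Saalschütz identity evaluates.
*)

Require Import Defs.
From mathcomp Require Import all_boot all_order all_algebra algC.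
From mathcomp Require Import zify ring.
Import Order.TTheory GRing.Theory Num.Theory.

Set Implicit Arguments.
Unset Strict Implicit.
Unset Printing Implicit Defensive.

(** * Sources of an ordering *)

Section Sources.

Variable G : sgraph.
Implicit Types (I J A : {set G}) (s t : seq G) (v x : G).

(** A vertex absent from [s] has index [size s], so it counts as a source iff it has no neighbour in
    [s]. With this convention the recursion on the head holds for all vertices. *)
Definition sources s : {set G} :=
  [set v | ~~ has (adj v) (take (index v s) s)].

Definition independent I : bool :=
  [forall u in I, forall v in I, ~~ adj u v].

Definition closed_nbhd I : {set G} :=
  [set x | [exists v in I, (x == v) || adj v x]].

Lemma independentP I :
  reflect {in I &, forall u v, ~~ adj u v} (independent I).
Proof.
apply: (iffP forall_inP) => [H u v uI vI|H u uI].
  by have /forall_inP := H u uI; apply.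
by apply/forall_inP => v vI; apply: H.
Qed.

Lemma independent_sub I J : J \subset I -> independent I -> independent J.
Proof.
move=> /subsetP sJI /independentP H; apply/independentP => u v uJ vJ.
by apply: H; apply: sJI.
Qed.

Lemma sub_closed_nbhd I : I \subset closed_nbhd I.
Proof.
apply/subsetP => v vI; rewrite inE; apply/existsP; exists v.
by rewrite vI eqxx.
Qed.

Lemma in_sources_cons v x t :
  (v \in sources (x :: t)) = (v == x) || ~~ adj v x && (v \in sources t).
Proof.
rewrite !inE /= [x == v]eq_sym; case: eqP => [->|_] //=.
by rewrite negb_or.
Qed.

(** The head [x] is always a source, hence [I :\ x]; since [adj] is irreflexive, the first condition
    may still range over all of [I]. *)
Lemma subset_sources_cons I x t :
  (I \subset sources (x :: t)) =
  [forall v in I, ~~ adj v x] && (I :\ x \subset sources t).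
Proof.
apply/subsetP/andP => [H|[/forall_inP Hx /subsetP H] v vI].
  split.
    apply/forall_inP => v /H; rewrite in_sources_cons.
    by case: eqP => [->|_ /andP[]//]; rewrite adj_irrefl.
  apply/subsetP => v; rewrite in_setD1 => /andP[vx /H].
  by rewrite in_sources_cons (negbTE vx) /= => /andP[].
rewrite in_sources_cons; case: eqP => //= /eqP vx.
by rewrite Hx //= H // in_setD1 vx.
Qed.

(** Of two adjacent vertices the later one is preceded by a neighbour. *)
Lemma sources_independent s : uniq s -> {subset G <= s} ->
  independent (sources s).
Proof.
move=> us sG; apply/independentP => u v; rewrite !inE => /hasPn Hu /hasPn Hv.
have [uv|vu|E] := ltngtP (index u s) (index v s).
- rewrite (adj_sym u); apply: Hv; rewrite -(nth_index u (sG u isT)).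
  rewrite -(nth_take _ uv) mem_nth // size_take.
  by have := sG u isT; rewrite -index_mem; case: ifP; lia.
- apply: Hu; rewrite -(nth_index v (sG v isT)).
  rewrite -(nth_take _ vu) mem_nth // size_take.
  by have := sG v isT; rewrite -index_mem; case: ifP; lia.
- have -> : u = v by rewrite -(nth_index u (sG u isT)) E nth_index // sG.
  by rewrite adj_irrefl.
Qed.

Lemma count_permutations (P : pred (seq G)) s : uniq s -> 0 < size s ->
  count P (permutations s) =
  \sum_(x <- s) count (fun t => P (x :: t)) (permutations (rem x s)).
Proof.
move=> us s_gt0; rewrite (permP (permutationsE s_gt0)) (undup_id us).
rewrite count_flatten sumnE !big_map; apply: eq_bigr => x _.
by rewrite count_map; apply: eq_count.
Qed.

(* The head of the ordering is either one of the [#|I|] prescribed sources or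
   one of the [size s - d #|I|] vertices outside their closed neighbourhood. *)
Lemma count_sub_sources (d : nat -> nat) :
  (forall I, independent I -> #|closed_nbhd I| = d #|I|) ->
  forall s I, uniq s -> independent I -> {subset closed_nbhd I <= s} ->
  count (fun t => I \subset sources t) (permutations s)
    * \prod_(1 <= i < #|I|.+1) d i = (size s)`! * #|I|`!.
Proof.
move=> dE s; move: {2}(size s) (erefl (size s)) => N.
elim: N s => [|N IHN] s sN I us indI sI.
  move/size0nil: sN => s0; subst s.
  have -> : I = set0.
    apply/setP => x; rewrite in_set0; apply/negbTE/negP => xI.
    by have := sI x (subsetP (sub_closed_nbhd I) _ xI).
  by rewrite cards0 big_geq // /= sub0set.
rewrite count_permutations ?sN // big_distrl /=.
set P := \prod_(1 <= i < _) _.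
pose P' := \prod_(1 <= i < #|I|) d i.
have PE : 0 < #|I| -> P = P' * d #|I|.
  by move=> I0; rewrite /P big_nat_recr.
(* A head in [I] leaves [I :\ x], whose product lacks the factor [d #|I|] of [P]. A head outside the
   closed neighbourhood leaves [I] intact. Any other head is adjacent to a member of [I] and
   contributes nothing. *)
transitivity (\sum_(x <- s) ((x \in I) * (N`! * #|I|.-1`! * d #|I|)
    + (x \notin closed_nbhd I) * (N`! * #|I|`!))).
  apply: eq_big_seq => x xs.
  have urem : uniq (rem x s) by rewrite rem_uniq.
  have sizerem : size (rem x s) = N by rewrite size_rem // sN.
  have Hc t : (I \subset sources (x :: t)) =
    [forall v in I, ~~ adj v x] && (I :\ x \subset sources t).
    exact: subset_sources_cons.
  rewrite (eq_count Hc).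
  case: (boolP (x \in I)) => xI.
    rewrite (subsetP (sub_closed_nbhd I) _ xI) /= mul0n addn0 mul1n.
    have -> /= : [forall v in I, ~~ adj v x].
      by apply/forall_inP => v vI; apply: (independentP _ indI).
    have cI : #|I| = #|I :\ x|.+1 by rewrite (cardsD1 x) xI.
    rewrite PE ?cI // /P' cI /= mulnA IHN ?sizerem //.
      by apply: independent_sub indI; apply: subsetDl.
    move=> y; rewrite inE => /existsP[v /andP[]].
    rewrite in_setD1 => /andP[vx vI] /orP H; rewrite mem_rem_uniq // inE /=.
    apply/andP; split.
      case: H => [/eqP->//|]; apply: contraTneq => ->.
      by apply: (independentP _ indI).
    by apply: sI; rewrite inE; apply/existsP; exists v; rewrite vI; apply/orP.
  rewrite mul0n add0n.
  have ID : I :\ x = I.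
    apply/setP => y; rewrite in_setD1.
    by case: eqP => // ->; rewrite (negbTE xI).
  case: (boolP (x \in closed_nbhd I)) => xN.
    have /negbTE -> /= : ~~ [forall v in I, ~~ adj v x].
      move: xN; rewrite inE => /existsP[v /andP[vI]].
      case: eqP => [E|_ /= avx]; first by rewrite E vI in xI.
      by apply/negP => /forall_inP/(_ v vI); rewrite avx.
    by rewrite count_pred0.
  have -> /= : [forall v in I, ~~ adj v x].
    apply/forall_inP => v vI; apply: contra xN => avx.
    by rewrite inE; apply/existsP; exists v; rewrite vI avx orbT.
  rewrite ID IHN ?sizerem // ?mul1n // => y yN.
  rewrite mem_rem_uniq // inE /= sI // andbT.
  by apply: contraNneq xN => <-.
rewrite big_split /= -!big_distrl /=.
have cntE A : {subset A <= s} -> \sum_(x <- s) (x \in A : nat) = #|A|.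
  move=> sA; rewrite big_uniq // -sum1_card big_mkcond [RHS]big_mkcond.
  apply: eq_bigr => x _; case: (boolP (x \in A)) => [/sA ->//|_].
  by case: ifP.
have -> : \sum_(x <- s) (x \in I : nat) = #|I|.
  by apply: cntE => x xI; apply: sI; apply: (subsetP (sub_closed_nbhd I)).
have E : \sum_(x <- s) (x \notin closed_nbhd I : nat) + d #|I| = N.+1.
  rewrite -dE // -(cntE _ sI) -big_split /= -sN -sum1_size.
  by apply: eq_bigr => x _; case: (_ \in _).
rewrite factS -E mulnDl mulnDl addnC; congr (_ + _); first by rewrite mulnA.
(* For empty [I] no head lies in [I], so the remaining term must vanish: [d 0] is the size of the
   empty closed neighbourhood. *)
case: #|I| => [|k]; last by rewrite factS /=; ring.
have -> : d 0 = 0.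
  have := dE set0; rewrite cards0 => <-; last first.
    by apply/independentP => u v; rewrite in_set0.
  apply/eqP; rewrite cards_eq0; apply/eqP/setP => x; rewrite !inE.
  by apply/existsP => -[v]; rewrite in_set0.
by rewrite !mul0n.
Qed.

(** * Successive orderings are those with a single source *)

Lemma induces_connected_from A h : h \in A ->
  (forall x, x \in A -> connect (induced_rel A) h x) -> induces_connected A.
Proof.
move=> hA H.
have symA : symmetric (induced_rel A).
  by move=> x y; rewrite /induced_rel /= andbCA (adj_sym x).
apply/forall_inP => x xA; apply/forall_inP => y yA.
by apply: connect_trans (H y yA); rewrite (sym_connect_sym symA) H.
Qed.

Lemma head_source h t : h \in sources (h :: t).
Proof. by rewrite in_sources_cons eqxx. Qed.

(** For [v] other than [h], the prefix ending in [v] contains a path from [v] to [h]; its first step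
    reaches a neighbour that precedes [v]. *)
Lemma sources_successive h t : uniq (h :: t) -> {subset G <= h :: t} ->
  (forall i, i <= size (h :: t) ->
     induces_connected [set x in take i (h :: t)]) ->
  sources (h :: t) = [set h].
Proof.
move=> us sG conn; apply/setP => v; rewrite in_set1.
case: eqP => [->|/eqP vh]; first exact: head_source.
rewrite inE; apply/negbTE; rewrite negbK.
set s := h :: t in us sG conn *; pose i := index v s.
have iN : i < size s by rewrite index_mem sG.
have /forall_inP/(_ v) := conn i.+1 iN.
have vE : nth h s i = v by rewrite nth_index // sG.
have takeE : take i.+1 s = rcons (take i s) v by rewrite (take_nth h) ?vE.
rewrite takeE inE mem_rcons mem_head => /(_ isT)/forall_inP/(_ h).
rewrite inE -takeE /= mem_head => /(_ isT)/connectP[[|y q] /=].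
  by move=> _ E; rewrite E eqxx in vh.
case/andP => /and3P[_]; rewrite !inE => yi avy _ _.
apply/hasP; exists y => //; rewrite -/i.
have : y \in take i.+1 s by rewrite /= inE.
rewrite takeE mem_rcons inE; case: eqP => [E|//].
by rewrite E adj_irrefl in avy.
Qed.

(** Induction on the prefix: its new last vertex is not a source, so it has an earlier neighbour,
    which is already connected to [h]. *)
Lemma successive_sources h t : uniq (h :: t) -> sources (h :: t) = [set h] ->
  forall i, induces_connected [set x in take i (h :: t)].
Proof.
set s := h :: t => us sh [|i].
  by apply/forall_inP => x; rewrite inE take0.
apply: (@induces_connected_from _ h); first by rewrite inE /= mem_head.
elim: i => [|i IH] x.
  by rewrite inE /= take0 mem_seq1 => /eqP ->; apply: connect0.
have [iN|iN] := ltnP i.+1 (size s); last first.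
  move: IH; rewrite !take_oversize //; first by apply.
  exact: leqW.
have mono : subrel (induced_rel [set x in take i.+1 s])
                   (connect (induced_rel [set x in take i.+2 s])).
  have sub : {subset take i.+1 s <= take i.+2 s}.
    by move=> z zi; rewrite (take_nth h) // mem_rcons inE zi orbT.
  move=> y z /and3P[]; rewrite !in_set => yi zi ayz.
  by apply/connect1/and3P; rewrite !in_set !sub.
have takeE := take_nth h iN.
rewrite in_set takeE mem_rcons in_cons => /orP[/eqP ->|xi]; last first.
  by rewrite -takeE; apply: (connect_sub mono); apply: IH; rewrite in_set.
set v := nth h s i.+1.
have : v \notin sources s.
  by rewrite sh in_set1 -[h]/(nth h s 0) nth_uniq.
rewrite inE negbK index_uniq // => /hasP[y yi avy].
apply: (@connect_trans _ _ y).
  by rewrite -takeE; apply: (connect_sub mono); apply: IH; rewrite in_set.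
apply/connect1/and3P; rewrite !in_set !mem_rcons mem_head (adj_sym y).
by split=> //; apply/orP; right.
Qed.

Lemma uniq_full s : uniq s -> size s = #|G| -> s =i enum G.
Proof.
move=> us sz.
have sub : {subset s <= enum G} by move=> x _; rewrite mem_enum.
by have [|_] := uniq_min_size us sub; rewrite // -cardE sz.
Qed.

(** The head is always a source, so a single source must be the head. On the empty graph the empty
    ordering is successive but has no source, whence the positivity hypothesis. *)
Lemma nb_successive_orderingsE : 0 < #|G| ->
  nb_successive_orderings G =
  count (fun s => #|sources s| == 1) (permutations (enum G)).
Proof.
move=> G0; rewrite /nb_successive_orderings cardE -size_filter.
rewrite -(size_map val); apply: perm_size; apply: uniq_perm.
- by rewrite map_inj_uniq ?enum_uniq //; apply: val_inj.
- by rewrite filter_uniq // permutations_uniq.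
have key (s : seq G) : uniq s -> size s = #|G| ->
    (#|sources s| == 1) =
    [forall i : 'I_#|G|.+1, induces_connected [set x in take i s]].
  move=> us sz.
  have sG : {subset G <= s}.
    by move=> x _; rewrite (uniq_full us sz) mem_enum.
  case: s us sz sG => [|h t] us sz sG; first by rewrite -sz in G0.
  apply/cards1P/forallP => [[x xE] i|H].
    apply: successive_sources => //.
    by have := head_source h t; rewrite xE in_set1 => /eqP <-.
  exists h; apply: sources_successive => // i iN.
  by rewrite sz in iN; apply: (H (Ordinal (iN : i < #|G|.+1))).
move=> s; rewrite mem_filter mem_permutations.
apply/mapP/andP => [[u]|[src pe]].
  rewrite mem_enum inE => /andP[uu succ] ->; split.
    by rewrite key ?size_tuple.
  apply: uniq_perm; rewrite ?enum_uniq //.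
  by apply: uniq_full; rewrite ?size_tuple.
have sz : size s == #|G| by rewrite (perm_size pe) -cardE.
have us : uniq s by rewrite (perm_uniq pe) enum_uniq.
exists (Tuple sz) => //; rewrite mem_enum inE us /=.
by rewrite /successive -key //=; apply/eqP.
Qed.

End Sources.

(** * The line graph of the complete tripartite hypergraph *)

Section TripartiteEdges.

Variables m n p : nat.
Local Notation G := (line_graph (K3 m n p)).
Implicit Types (t : 'I_m * 'I_n * 'I_p) (e f : G) (I : {set G}).

Definition edge t : {set K3_vertex m n p} :=
  [set inl (inl t.1.1); inl (inr t.1.2); inr t.2].

Lemma edge_inj : injective edge.
Proof.
move=> [[i j] k] [[i' j'] k'] /setP E.
have := E (inl (inl i)); have := E (inl (inr j)); have := E (inr k).
rewrite !inE /= !(inj_eq inl_inj, inj_eq inr_inj) !eqxx ?orbT ?orbF /=.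
by move=> /esym/eqP-> /esym/eqP-> /esym/eqP->.
Qed.

Lemma edge_K3 t : edge t \in K3 m n p.
Proof.
case: t => [[i j] k]; rewrite inE /edge /=; apply/and4P; split.
- by rewrite setUC cardsU1 cards2 !inE.
- apply/cards1P; exists (inl (inl i)); apply/setP => v; rewrite !inE.
  case: v => [[u|u]|u]; rewrite /= ?orbF.
  + by rewrite (imset_f (fun i => inl (inl i))) // andbT.
  + by apply/negbTE/nandP; right; apply/imsetP => -[].
  + by apply/negbTE/nandP; right; apply/imsetP => -[].
- apply/cards1P; exists (inl (inr j)); apply/setP => v; rewrite !inE.
  case: v => [[u|u]|u]; rewrite /= ?orbF.
  + by apply/negbTE/nandP; right; apply/imsetP => -[].
  + by rewrite (imset_f (fun i => inl (inr i))) // andbT.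
  + by apply/negbTE/nandP; right; apply/imsetP => -[].
- apply/cards1P; exists (inr k); apply/setP => v; rewrite !inE.
  case: v => [[u|u]|u]; rewrite /= ?orbF.
  + by apply/negbTE/nandP; right; apply/imsetP => -[].
  + by apply/negbTE/nandP; right; apply/imsetP => -[].
  + by rewrite (imset_f inr) // andbT.
Qed.

Lemma K3_edge (e : {set K3_vertex m n p}) :
  e \in K3 m n p -> exists t, e == edge t.
Proof.
rewrite inE => /and4P[_ /cards1P[x1 /setP E1] /cards1P[x2 /setP E2]].
move=> /cards1P[x3 /setP E3].
have := E1 x1; rewrite set11 in_setI => /andP[_ /imsetP[i _ x1E]].
have := E2 x2; rewrite set11 in_setI => /andP[_ /imsetP[j _ x2E]].
have := E3 x3; rewrite set11 in_setI => /andP[_ /imsetP[k _ x3E]].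
exists (i, j, k); apply/eqP/setP => v; rewrite !in_setU !in_set1 /=.
case: v => [[u|u]|u]; rewrite /= ?orbF.
- have := E1 (inl (inl u)).
  by rewrite in_setI (imset_f (fun i => inl (inl i))) // andbT in_set1 x1E.
- have := E2 (inl (inr u)).
  by rewrite in_setI (imset_f (fun i => inl (inr i))) // andbT in_set1 x2E.
- have := E3 (inr u).
  by rewrite in_setI (imset_f inr) // andbT in_set1 x3E.
Qed.

Definition coords e : 'I_m * 'I_n * 'I_p := xchoose (K3_edge (valP e)).

Lemma coordsK e : val e = edge (coords e).
Proof. exact/eqP/(xchooseP (K3_edge (valP e))). Qed.

Lemma coords_bij : bijective coords.
Proof.
exists (fun t => (exist _ (edge t) (edge_K3 t) : G)) => [e|t].
  by apply: val_inj; rewrite /= -coordsK.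
by apply: edge_inj; rewrite -coordsK.
Qed.

Lemma edges_meet e f : (val e :&: val f != set0) =
  [|| (coords e).1.1 == (coords f).1.1, (coords e).1.2 == (coords f).1.2
    | (coords e).2 == (coords f).2].
Proof.
rewrite !coordsK; apply/set0Pn/or3P => [[v]|].
  rewrite !inE => /andP[/orP[/orP[]|] /eqP->];
  rewrite /= !(inj_eq inl_inj, inj_eq inr_inj) /= ?orbF => H;
  by [constructor 1|constructor 2|constructor 3].
case=> /eqP E.
- by exists (inl (inl (coords e).1.1)); rewrite !inE E eqxx.
- by exists (inl (inr (coords e).1.2)); rewrite !inE E eqxx ?orbT.
- by exists (inr (coords e).2); rewrite !inE E eqxx ?orbT.
Qed.

Lemma adj_line_graph e f : adj e f = (e != f) && (val e :&: val f != set0).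
Proof. by []. Qed.

(** A hyperedge lies outside the closed neighbourhood iff it misses every vertex covered by [I]; in
    coordinates this is a box. *)
Lemma closed_nbhd_line_graph I : ~: closed_nbhd I = coords @^-1:
  setX (setX (~: [set (coords v).1.1 | v in I])
             (~: [set (coords v).1.2 | v in I]))
       (~: [set (coords v).2 | v in I]).
Proof.
apply/setP => e; rewrite in_setC in_set [RHS]in_set.
rewrite (surjective_pairing (coords e)) (surjective_pairing (coords e).1).
rewrite !in_setX !in_setC -!negb_or; congr (~~ _).
apply/existsP/orP => [[v /andP[vI]]|].
  move=> H.
  have : val v :&: val e != set0.
    case/orP: H => [/eqP->|]; last by rewrite adj_line_graph => /andP[].
    by rewrite edges_meet eqxx.
  rewrite edges_meet => /or3P[] /eqP E;
  [left; apply/orP; left|left; apply/orP; right|right];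
  by apply/imsetP; exists v.
have meet v : v \in I -> val v :&: val e != set0 ->
    exists x, (x \in I) && ((e == x) || adj x e).
  move=> vI ve; exists v; rewrite vI adj_line_graph ve eq_sym andbT.
  by case: (v == e).
case=> [/orP[]|] /imsetP[v vI E]; apply: (meet v vI);
  by rewrite edges_meet E eqxx ?orbT.
Qed.

(** Independent hyperedges are pairwise disjoint, so [I] covers exactly [#|I|] vertices of each
    class. *)
Lemma line_graph_fully_regular I : independent I ->
  #|~: closed_nbhd I| = (m - #|I|) * (n - #|I|) * (p - #|I|).
Proof.
move=> /independentP indI; rewrite closed_nbhd_line_graph.
have cardC (q : nat) (f : G -> 'I_q) :
    (forall u v, f u = f v -> val u :&: val v != set0) ->
    #|~: [set f v | v in I]| = q - #|I|.
  move=> fmeet; rewrite cardsCs setCK card_ord card_in_imset // => u v uI vI fuv.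
  have := indI u v uI vI; rewrite adj_line_graph fmeet // andbT negbK.
  by move/eqP.
rewrite on_card_preimset; last exact/onW_bij/coords_bij.
by rewrite !cardsX !cardC // => u v E; rewrite edges_meet E eqxx ?orbT.
Qed.

End TripartiteEdges.

Local Open Scope ring_scope.

(** * Successive orderings of fully regular graphs *)

(** Absorbing [k] into the binomial coefficient leaves the expansion of [(1 - 1) ^ (n - 1)]. *)
Lemma sum_alt_binomial n :
  \sum_(0 <= k < n.+1) (-1) ^+ k * k%:R * 'C(n, k)%:R = - (n == 1%N)%:R :> rat.
Proof.
case: n => [|n]; first by rewrite big_nat1 mulr0 mul0r oppr0.
rewrite big_nat_recl // mulr0 mul0r add0r.
rewrite (eq_bigr (fun k => - n.+1%:R * ('C(n, k)%:R * (-1) ^+ k))); last first.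
  move=> k _; rewrite -mulrA -natrM -mul_bin_diag natrM exprS /=; ring.
rewrite -mulr_sumr big_mkord.
have -> : \sum_(k < n.+1) ('C(n, k)%:R * (-1) ^+ k) = (1 + -1) ^+ n :> rat.
  by rewrite exprDn; apply: eq_bigr => k _; rewrite expr1n mul1r mulr_natl.
rewrite subrr expr0n; case: n => [|n] /=; first by rewrite mulr1.
by rewrite mulr0 oppr0.
Qed.

Lemma sum_alt_card_subsets (T : finType) (B : {set T}) :
  \sum_(A : {set T} | A \subset B) (-1) ^+ #|A| * #|A|%:R
    = - (#|B| == 1%N)%:R :> rat.
Proof.
rewrite -sum_alt_binomial big_mkord.
pose f (A : {set T}) : 'I_#|B|.+1 := inord #|A|.
rewrite (partition_big f predT) //=; apply: eq_bigr => k _.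
rewrite -cards_draws -[#|[set _ | _]|]sum1_card natr_sum mulr_sumr.
have E (A : {set T}) : (A \subset B) && (f A == k)
   = (A \in [set A : {set T} | A \subset B & #|A| == k]).
  rewrite inE; case: (boolP (A \subset B)) => //= /subset_leq_card AB.
  by rewrite -val_eqE /= inordK.
rewrite (eq_bigl _ _ E); apply: eq_bigr => A.
by rewrite inE mulr1 => /andP[_ /eqP->].
Qed.

Section FullyRegular.

Variables (G : sgraph) (a : nat -> nat).
Hypothesis G_gt0 : (0 < #|G|)%N.
Hypothesis fully_regular :
  forall I : {set G}, independent I -> #|~: closed_nbhd I| = a #|I|.

Let independents k := [set I : {set G} | independent I & #|I| == k].

Lemma independent0 : independent (set0 : {set G}).
Proof. by apply/independentP => u v; rewrite in_set0. Qed.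

Lemma fully_regular0 : a 0%N = #|G|.
Proof.
rewrite -(@cards0 G) -(fully_regular independent0) -cardsT; congr #|pred_of_set _|.
by apply/setP => x; rewrite !inE; apply/existsP => -[v]; rewrite in_set0.
Qed.

Lemma independentU1 (x : G) (I : {set G}) :
  (x \notin I) && independent (x |: I) = independent I && (x \notin closed_nbhd I).
Proof.
apply/andP/andP => [[xI /independentP H]|[/independentP H xN]].
  split; first by apply/independentP => u v uI vI; apply: H; apply: setU1r.
  rewrite inE; apply/existsP => -[v /andP[vI /orP[/eqP E|avx]]].
    by rewrite E vI in xI.
  by have := H v x (setU1r _ vI) (setU11 _ _); rewrite avx.
have xI : x \notin I by apply: contra xN; apply: (subsetP (sub_closed_nbhd I)).
have Hx v : v \in I -> ~~ adj v x.
  move=> vI; apply: contra xN => avx.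
  by rewrite inE; apply/existsP; exists v; rewrite vI avx orbT.
split=> //; apply/independentP => u v; rewrite !in_setU1.
case/predU1P=> [->|uI] /predU1P[->|vI]; last exact: H.
- by rewrite adj_irrefl.
- by rewrite adj_sym Hx.
- exact: Hx.
Qed.

(** Double counting of the pairs of an independent [k]-set and a vertex outside its closed
    neighbourhood: adjoining the vertex gives an independent set of size [k + 1] with a marked
    element. *)
Lemma card_independentsS k :
  (k.+1 * #|independents k.+1| = a k * #|independents k|)%N.
Proof.
have -> : (k.+1 * #|independents k.+1|
    = \sum_(J in independents k.+1) \sum_(x in J) 1)%N.
  rewrite mulnC -sum_nat_const; apply: eq_bigr => J.
  by rewrite inE sum1_card => /andP[_ /eqP->].
have -> : (a k * #|independents k|
    = \sum_(I in independents k) \sum_(x in ~: closed_nbhd I) 1)%N.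
  rewrite mulnC -sum_nat_const; apply: eq_bigr => I.
  by rewrite inE sum1_card => /andP[iI /eqP<-]; rewrite fully_regular.
rewrite (exchange_big_dep predT) //= [RHS](exchange_big_dep predT) //=.
apply: eq_bigr => x _.
rewrite (reindex_onto (fun I : {set G} => x |: I) (fun J => J :\ x)) /=; last first.
  by move=> J /andP[_ xJ]; rewrite setD1K.
apply: eq_bigl => I; rewrite in_setC setU11 andbT.
rewrite ![_ \in independents _]in_set.
have -> : ((x |: I) :\ x == I) = (x \notin I).
  apply/eqP/idP => [<-|xI]; last exact: setU1K.
  by rewrite !inE eqxx.
rewrite -andbA [RHS]andbAC -independentU1 cardsU1.
by case: (x \in I); rewrite ?andbF //= add1n eqSS andbT.
Qed.

Lemma card_independents k :
  (k`! * #|independents k| = \prod_(i < k) a i)%N.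
Proof.
elim: k => [|k IHk].
  rewrite big_ord0 mul1n (_ : independents 0 = [set set0]) ?cards1 //.
  apply/setP => I; rewrite !inE cards_eq0.
  case: eqP => [->|]; last by rewrite andbF.
  by rewrite independent0.
rewrite big_ord_recr /= -IHk factS -mulnA mulnC -!mulnA [(_ * k.+1)%N]mulnC.
by rewrite card_independentsS [(a k * _)%N]mulnC.
Qed.

Lemma successive_fully_regular :
  (nb_successive_orderings G)%:R
  = - (#|G|`!%:R * \sum_(0 <= k < #|G|.+1) (-1) ^+ k * k%:R
        * ((\prod_(i < k) a i)%:R / \prod_(1 <= i < k.+1) (a 0 - a i)%:R)) :> rat.
Proof.
rewrite nb_successive_orderingsE // -sum1_count natr_sum big_mkcond /=.
rewrite (eq_bigr (fun s => - \sum_(I : {set G} | I \subset sources s)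
   (-1) ^+ #|I| * #|I|%:R)); last first.
  by move=> s _; rewrite sum_alt_card_subsets opprK; case: eqP.
rewrite sumrN; congr (- _).
rewrite (exchange_big_dep predT) //= big_mkord mulr_sumr.
have dE (I : {set G}) : independent I -> #|closed_nbhd I| = (a 0 - a #|I|)%N.
  move=> iI; rewrite fully_regular0 -(fully_regular iI).
  by rewrite -(cardsC (closed_nbhd I)) addnK.
pose f (I : {set G}) : 'I_#|G|.+1 := inord #|I|.
have fE (I : {set G}) : f I = #|I| :> nat by rewrite inordK // ltnS max_card.
rewrite (partition_big f predT) //=; apply: eq_bigr => k _.
pose P : rat := \prod_(1 <= i < k.+1) (a 0 - a i)%:R.
transitivity (\sum_(I in independents k)
  (-1) ^+ k * k%:R * (#|G|`!%:R * k`!%:R / P)).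
  rewrite [RHS]big_mkcond [LHS]big_mkcond; apply: eq_bigr => I _.
  rewrite inE -val_eqE /= fE; case: (#|I| =P k) => [Ik|_]; last by rewrite andbF.
  rewrite andbT big_const_seq iter_addr_0 -[_ *+ count _ _]mulr_natr Ik.
  (* Sources are pairwise nonadjacent, so a dependent [I] is counted by no ordering. *)
  case: (boolP (independent I)) => iI; last first.
    rewrite (_ : count _ _ = 0%N) ?mulr0 //.
    apply/eqP; rewrite -leqn0 leqNgt -has_count; apply/hasPn => s.
    rewrite mem_permutations => pe; apply: contra iI => Is.
    apply: independent_sub Is _; apply: sources_independent.
      by rewrite (perm_uniq pe) enum_uniq.
    by move=> x _; rewrite (perm_mem pe) mem_enum.
  have subG : {subset closed_nbhd I <= enum G} by move=> x _; rewrite mem_enum.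
  have := @count_sub_sources G (fun i => a 0 - a i)%N dE _ _
            (enum_uniq G) iI subG.
  rewrite Ik -cardE => /(congr1 (fun n => n%:R : rat)).
  rewrite !natrM natr_prod -/P => cE.
  (* [P] is nonzero because its product with the count is a product of factorials. *)
  congr (_ * _); rewrite -cE mulfK //.
  apply: contraTneq isT => P0; move/eqP: cE.
  by rewrite P0 mulr0 eq_sym mulf_eq0 !pnatr_eq0 !eqn0Ngt !fact_gt0.
rewrite sumr_const -[_ *+ #|_|]mulr_natr -card_independents natrM -/P.
ring.
Qed.

End FullyRegular.

(** * The Pfaff-Saalschütz identity *)

(** The Pochhammer symbol. *)
Definition rising {R : pzRingType} (x : R) (k : nat) : R :=
  \prod_(i < k) (x + i%:R).

Section Rising.
Variable R : comNzRingType.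
Implicit Types a b c x : R.

Lemma rising0 x : rising x 0 = 1.
Proof. by rewrite /rising big_ord0. Qed.

Lemma risingS x k : rising x k.+1 = rising x k * (x + k%:R).
Proof. by rewrite /rising big_ord_recr. Qed.

Lemma risingSl x k : rising x k.+1 = x * rising (x + 1) k.
Proof.
rewrite /rising big_ord_recl addr0; congr (_ * _).
by apply: eq_bigr => i _; rewrite lift0 -nat1r addrA.
Qed.

(* Cleared of the denominators [(c)_N (c - a - b)_N], the identity holds in any
   commutative ring. *)
Lemma pfaff_saalschutz a b c N :
  \sum_(0 <= k < N.+1) 'C(N, k)%:R * rising a k * rising b k
     * rising (c + k%:R) (N - k) * rising (c - a - b) (N - k)
  = rising (c - a) N * rising (c - b) N.
Proof.
set d := c - a - b.
elim: N => [|N IHN].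
  by rewrite big_nat1 !rising0 bin0 !mulr1.
rewrite !risingS.
pose F k := 'C(N, k)%:R * rising a k * rising b k
     * rising (c + k%:R) (N - k) * rising d (N - k).
(* [D] is the telescoping certificate of the induction step: the summands of the two sides differ by
   [D k.+1 - D k], and [D] vanishes at both ends. *)
pose D k := k%:R * 'C(N, k)%:R * rising a k * rising b k
     * rising (c + k%:R) (N - k) * rising d (N.+1 - k).
have D0 : D 0%N = 0 by rewrite /D !mul0r.
have DN : D N.+1 = 0 by rewrite /D bin_small // mulr0 !mul0r.
have -> : rising (c - a) N * (c - a + N%:R) * (rising (c - b) N * (c - b + N%:R))
   = \sum_(0 <= k < N.+1) F k * ((c - a + N%:R) * (c - b + N%:R)).
  by rewrite -mulr_suml IHN mulrACA.
pose H k := 'C(N, k)%:R * rising a k.+1 * rising b k.+1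
     * rising (c + k.+1%:R) (N - k) * rising d (N - k).
(* Pascal's rule: the part with ['C(N, k)] is [F k] times the two new last factors, and the part
   with the lower binomial coefficient, shifted by one, is [H]. *)
have -> : \sum_(0 <= k < N.+2) 'C(N.+1, k)%:R * rising a k * rising b k
     * rising (c + k%:R) (N.+1 - k) * rising d (N.+1 - k)
  = \sum_(0 <= k < N.+1) (F k * (c + N%:R) * (d + (N - k)%:R) + H k).
  rewrite big_nat_recl //.
  under eq_bigr => k _ do rewrite binS natrD !mulrDl.
  rewrite big_split /= addrA big_split /=; congr (_ + _).
  rewrite [RHS]big_nat_recl // bin0 [X in _ + X]big_nat_recr //= bin_small //.
  rewrite !mul0r [in LHS]addr0; congr (_ + _).
    by rewrite /F !subn0 bin0 !risingS !addr0; ring.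
  rewrite addr0; apply: eq_big_nat => k /andP[_ kN]; rewrite /F.
  rewrite (_ : (N.+1 - k.+1)%N = (N - k.+1).+1); last by lia.
  rewrite !(risingS _ (N - k.+1)).
  rewrite (_ : c + k.+1%:R + (N - k.+1)%:R = c + N%:R); last first.
    by rewrite -addrA -natrD subnKC.
  ring.
apply/eqP; rewrite -subr_eq0 -sumrB.
rewrite (eq_big_nat _ _ (F2 := fun k => D k.+1 - D k)); last first.
  move=> k /andP[_ kN]; rewrite /D /F /H.
  have [kN'|kN'] := ltnP k N; last first.
    have -> : k = N by lia.
    rewrite subnn !rising0 binn (@bin_small N N.+1) // !risingS /d.
    rewrite !subSnn !risingS !rising0; ring.
  rewrite subSS (_ : (N.+1 - k)%N = (N - k).+1); last by lia.
  have -> : k.+1%:R * 'C(N, k.+1)%:R = (N - k)%:R * 'C(N, k)%:R :> R.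
    by rewrite -!natrM mul_bin_left.
  have E : (N - k)%N = (N - k.+1).+1 by lia.
  have h1 : rising (c + k%:R) (N - k)
      = (c + k%:R) * rising (c + k.+1%:R) (N - k.+1).
    by rewrite E risingSl -addrA natr1.
  have h2 : rising (c + k.+1%:R) (N - k)
      = rising (c + k.+1%:R) (N - k.+1) * (c + N%:R).
    by rewrite {1}E risingS -addrA -natrD subnKC.
  rewrite h1 h2 !(risingS _ (N - k)) !(risingS _ k).
  rewrite natrB; last by lia.
  rewrite /d; ring.
by rewrite telescope_sumr // D0 DN subrr.
Qed.

End Rising.

Lemma rising_prod_nat (R : comNzRingType) (x : R) k l :
  rising (k%:R - x) l = \prod_(k <= i < k + l) (i%:R - x).
Proof.
elim: l => [|l IHl]; first by rewrite rising0 big_geq ?addn0.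
rewrite risingS IHl addnS big_nat_recr ?leq_addr //=; congr (_ * _).
by rewrite natrD; ring.
Qed.

(** The factors are read backwards, each with its sign changed. *)
Lemma rising_rev (R : comNzRingType) (x : R) k l :
  rising (x - (k + l)%:R) l
    = (-1) ^+ l * \prod_(k.+1 <= i < (k + l).+1) (i%:R - x).
Proof.
elim: l => [|l IHl]; first by rewrite rising0 big_geq ?addn0 // mulr1.
rewrite risingSl addnS big_nat_recr /=; last by lia.
have -> : x - (k + l).+1%:R + 1 = x - (k + l)%:R by rewrite -natr1; ring.
by rewrite IHl exprS; ring.
Qed.

Lemma rising_ffact (R : comNzRingType) n k :
  rising (- n%:R) k = (-1) ^+ k * (n ^_ k)%:R :> R.
Proof.
elim: k => [|k IHk]; first by rewrite rising0 ffactn0 mulr1.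
rewrite risingS IHk ffactnSr exprS natrM.
have [kn|nk] := leqP k n; first by rewrite natrB //; ring.
by rewrite ffact_small //; ring.
Qed.

(** * The alternating sum in terms of the roots of [b] *)

Section RootSum.

Variables (F : numFieldType) (m n p : nat) (r1 r2 : F).
Hypothesis sum_roots : r1 + r2 = m%:R + n%:R + p%:R.
Hypothesis mul_roots : r1 * r2 = m%:R * n%:R + n%:R * p%:R + m%:R * p%:R.
Hypothesis p_gt0 : (0 < p)%N.

Let beta (i : nat) : F := (i%:R - r1) * (i%:R - r2).
(** The signs of the two rising factorials cancel, so this is ['C(p, k) * m ^_ k * n ^_ k], written
    in hypergeometric form. *)
Let W k : F := 'C(p, k)%:R * rising (- m%:R) k * rising (- n%:R) k.

Lemma betaE i : beta i = i%:R ^+ 2 - (m%:R + n%:R + p%:R) * i%:R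
  + (m%:R * n%:R + n%:R * p%:R + m%:R * p%:R).
Proof. by rewrite -sum_roots -mul_roots /beta; ring. Qed.

(** The summand at [k.+1] is [T k.+1 - T k]. Here [T p] vanishes through ['C(p.-1, p)], and [T 0]
    cancels the summand at [0]. The identity lets the weight [k] in [root_sum] be replaced by
    [k - r1]. *)
Lemma root_sum0 :
  \sum_(0 <= k < p.+1) (-1) ^+ k * W k * \prod_(k.+1 <= i < p.+1) beta i = 0.
Proof.
pose T k : F := (-1) ^+ k * 'C(p.-1, k)%:R * rising (1 - m%:R) k
  * rising (1 - n%:R) k * \prod_(k.+1 <= i < p.+1) beta i.
rewrite big_nat_recl // (@telescope_sumr_eq _ _ _ T) //; last first.
  move=> k /andP[_ kp]; rewrite /T /W.
  rewrite (@big_ltn _ _ _ k.+1 p.+1) ?ltnS //.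
  set B := \prod_(k.+2 <= i < p.+1) _.
  rewrite !(risingSl (- _%:R)) ![- _%:R + 1]addrC !(risingS (1 - _)) !exprS.
  have k1 : k.+1%:R != 0 :> F by rewrite pnatr_eq0.
  (* Multiplying by [k.+1] turns both binomial coefficients into multiples of ['C(p.-1, k)]. *)
  apply: (mulfI k1).
  have E1 : k.+1%:R * 'C(p, k.+1)%:R = p%:R * 'C(p.-1, k)%:R :> F.
    by rewrite -!natrM mul_bin_diag.
  have E2 : k.+1%:R * 'C(p.-1, k.+1)%:R = (p%:R - k.+1%:R) * 'C(p.-1, k)%:R :> F.
    by rewrite -natrM mul_bin_left natrM -natrB // -subn1 -subnDA add1n.
  set R1 := rising _ _; set R2 := rising _ _.
  transitivity (- (-1) ^+ k * (k.+1%:R * 'C(p, k.+1)%:R)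
     * (m%:R * n%:R * R1 * R2) * B); first by ring.
  transitivity (- (-1) ^+ k * (k.+1%:R * 'C(p.-1, k.+1)%:R)
     * (R1 * (1 - m%:R + k%:R) * (R2 * (1 - n%:R + k%:R))) * B
     - (-1) ^+ k * k.+1%:R * 'C(p.-1, k)%:R * R1 * R2 * beta k.+1 * B); last by ring.
  rewrite E1 E2 betaE -natr1; ring.
rewrite {1}/T {1}/W !rising0 !bin0 {1}/T bin_small; last by rewrite prednK.
by rewrite /T !rising0 !bin0; ring.
Qed.

Lemma root_sum :
  p%:R * \sum_(0 <= k < p.+1) (-1) ^+ k * k%:R * W k
           * \prod_(k.+1 <= i < p.+1) beta i
  = - \prod_(m <= i < (m + p).+1) beta i.
Proof.
have r2E : r2 = m%:R + n%:R + p%:R - r1 by rewrite -sum_roots; ring.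
(* With these parameters [c - a - b] is [r2 - p], so the two remaining rising factorials produce the
   factors [i - r1] and [i - r2] of [beta]. *)
have := pfaff_saalschutz (- m%:R) (- n%:R) (- r1) p.
move/(congr1 (fun x => (-1) ^+ p * (p%:R - r1) * x)).
move=> H.
have {H} XE : \sum_(0 <= k < p.+1) (-1) ^+ k * k%:R * W k
           * \prod_(k.+1 <= i < p.+1) beta i
   = (-1) ^+ p * (p%:R - r1)
     * (rising (- r1 - - m%:R) p * rising (- r1 - - n%:R) p).
  (* Subtracting [r1] times a zero sum changes the weight to [k - r1], which extends the product of
     the [i - r1] down to [i = k]; its last factor [p - r1] then comes out of the sum. *)
  rewrite -H; set X := LHS; transitivity (X - r1 * \sum_(0 <= k < p.+1)
      (-1) ^+ k * W k * \prod_(k.+1 <= i < p.+1) beta i).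
    by rewrite root_sum0 mulr0 subr0.
  rewrite /X !mulr_sumr -sumrB.
  apply: eq_big_nat => k; rewrite ltnS => /= kp.
  rewrite -/(W k) [X in rising X]addrC.
  have -> : - r1 - - m%:R - - n%:R = r2 - p%:R by rewrite r2E; ring.
  have E1 : (p%:R - r1) * rising (k%:R - r1) (p - k)
      = (k%:R - r1) * \prod_(k.+1 <= i < p.+1) (i%:R - r1).
    rewrite rising_prod_nat subnKC // mulrC -big_nat_recr //=.
    by rewrite big_ltn.
  have E2 : (-1) ^+ p * rising (r2 - p%:R) (p - k)
      = (-1) ^+ k * \prod_(k.+1 <= i < p.+1) (i%:R - r2).
    have -> : rising (r2 - p%:R) (p - k)
        = (-1) ^+ (p - k) * \prod_(k.+1 <= i < p.+1) (i%:R - r2).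
      by have := rising_rev r2 k (p - k); rewrite subnKC.
    rewrite mulrA -{1}(subnKC kp) exprD -(mulrA _ _ (_ ^+ _)) -expr2.
    by rewrite sqrr_sign mulr1.
  transitivity (W k * ((p%:R - r1) * rising (k%:R - r1) (p - k))
      * ((-1) ^+ p * rising (r2 - p%:R) (p - k))); last by ring.
  by rewrite E1 E2 big_split /=; ring.
rewrite XE !opprK ![- r1 + _]addrC rising_prod_nat.
have -> : n%:R - r1 = r2 - (m + p)%:R by rewrite natrD r2E; ring.
rewrite rising_rev big_split /=.
rewrite [\prod_(m <= i < (m + p).+1) (_ - r1)]big_nat_recr ?leq_addr //=.
rewrite [\prod_(m <= i < (m + p).+1) (_ - r2)]big_ltn ?ltnS ?leq_addr //.
set P1 := \prod_(m <= i < _) _; set P2 := \prod_(m.+1 <= i < _) _.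
(* The evaluated product lacks the factor [i - r1] at [i = m + p] and the factor [i - r2] at
   [i = m]; the prefactor supplies exactly these two. *)
have key : ((m + p)%:R - r1) * (m%:R - r2) = - (p%:R * (p%:R - r1)).
  transitivity (m%:R ^+ 2 + m%:R * p%:R - m%:R * (r1 + r2) - p%:R * r2 + r1 * r2).
    by rewrite natrD; ring.
  by rewrite sum_roots mul_roots r2E; ring.
transitivity (- (((m + p)%:R - r1) * (m%:R - r2)) * P1 * P2); last by ring.
rewrite key opprK; have := sqrr_sign F p; set sg := (-1) ^+ p => sg2.
transitivity (sg ^+ 2 * (p%:R * (p%:R - r1)) * P1 * P2); first by ring.
by rewrite sg2 mul1r.
Qed.

End RootSum.

(** The discriminant can be negative, as for [m = n = p = 1], so the roots are taken in [algC]. *)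
Lemma b_rootsE m n p : exists r1 r2 : algC,
  [/\ r1 + r2 = m%:R + n%:R + p%:R,
      r1 * r2 = m%:R * n%:R + n%:R * p%:R + m%:R * p%:R
    & forall i, (b m n p i)%:~R = (i%:R - r1) * (i%:R - r2)].
Proof.
pose S : algC := m%:R + n%:R + p%:R.
pose Q : algC := m%:R * n%:R + n%:R * p%:R + m%:R * p%:R.
pose D := sqrtC (S ^+ 2 - 4 * Q).
have DE : D ^+ 2 = S ^+ 2 - 4 * Q by rewrite sqrtCK.
have h1 : (S + D) / 2 + (S - D) / 2 = S by field.
have h2 : (S + D) / 2 * ((S - D) / 2) = Q.
  transitivity ((S ^+ 2 - D ^+ 2) / 4); first by field.
  by rewrite DE; field.
exists ((S + D) / 2), ((S - D) / 2); split=> // i.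
transitivity (i%:R ^+ 2 - ((S + D) / 2 + (S - D) / 2) * i%:R
   + (S + D) / 2 * ((S - D) / 2)); last by ring.
rewrite h1 h2 /b /S /Q !(rmorphB, rmorphD, rmorphM) /= ?rmorphB /=.
by rewrite -!pmulrn; ring.
Qed.

(** The roots have disappeared from this form of [root_sum], so it descends to the integers by
    injectivity of the embedding into [algC]. *)
Lemma alternating_sum_b m n p : (0 < p)%N ->
  p%:R * \sum_(0 <= k < p.+1) (-1) ^+ k * k%:R
     * ('C(p, k) * m ^_ k * n ^_ k)%:R * \prod_(k.+1 <= i < p.+1) b m n p i
  = - \prod_(m <= i < (m + p).+1) b m n p i.
Proof.
move=> p0; have [r1 [r2 [hS hQ bE]]] := b_rootsE m n p.
apply: (@intr_inj algC); rewrite rmorphN [in RHS]rmorph_prod rmorphM rmorph_sum /=.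
under [in RHS]eq_bigr => i _ do rewrite bE.
rewrite -(root_sum hS hQ p0) rmorph_nat; congr (_ * _).
apply: eq_bigr => k _; rewrite !rmorphM rmorph_prod /= rmorph_sign !rmorph_nat.
under [in LHS]eq_bigr => i _ do rewrite bE.
rewrite !rising_ffact ?natrM; congr (_ * _).
have := sqrr_sign algC k; set sg := (-1) ^+ k => sg2.
transitivity (sg * k%:R * ('C(p, k)%:R * (m ^_ k)%:R * (n ^_ k)%:R) * sg ^+ 2).
  by rewrite sg2 mulr1.
by ring.
Qed.

(** * Closed forms *)

Section ClosedForm.

Variables m n p : nat.
Hypotheses (m_gt0 : (0 < m)%N) (n_gt0 : (0 < n)%N) (p_gt0 : (0 < p)%N).
Local Notation b := (b m n p).
Local Notation B := (prod_b m n p).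

Lemma b_rev i : (i <= m + n + p)%N -> b (m + n + p - i) = b i.
Proof. by move=> iS; rewrite /Defs.b -subzn // !PoszD; ring. Qed.

(** For [i] at most each of [m], [n], [p] this is the identity [a 0 - a i = i b_i]; kept over the
    integers, it also yields the sign of [b i] for larger [i]. *)
Lemma mul_b i :
  i%:Z * b i = (m * n * p)%N%:Z + (i%:Z - m%:Z) * (i%:Z - n%:Z) * (i%:Z - p%:Z).
Proof. by rewrite /Defs.b !PoszM; ring. Qed.

Lemma prod_b_neq0 lo hi : B lo hi != 0.
Proof. by rewrite prodf_seq_neq0; apply/allP => i _; rewrite intr_eq0 implybb. Qed.

Lemma prod_bE lo hi : (forall i, (lo <= i <= hi)%N -> b i != 0) ->
  B lo hi = \prod_(lo <= i < hi.+1) (b i)%:~R.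
Proof.
move=> nz; rewrite /prod_b big_nat_cond [RHS]big_nat_cond; apply: eq_bigl => i.
by rewrite ltnS; case: (boolP (lo <= i <= hi)%N) => //= /nz ->.
Qed.

(** The range from [1] to [m + n + p - 1] is cut before [m] and after [m + p]. The reflection
    [b_rev] carries the last block to the indices from [1] to [n - 1], matching zero factors with
    zero factors. *)
Lemma closed_forms_eq :
  ((m * n * p - 1)`!)%:R * B 1%N (m + n + p - 1)%N
      / (B 1%N (m - 1)%N * B 1%N (n - 1)%N * B 1%N (p - 1)%N)
    = ((m * n * p)`!)%:R
      * (B m (m + p)%N / ((m * n * p)%N%:R * B 1%N (p - 1)%N)).
Proof.
have E : B 1 (m + n + p - 1) = B 1 (m - 1) * B m (m + p) * B 1 (n - 1).
  rewrite /prod_b !subn1 !prednK // ?addn_gt0 ?m_gt0 //.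
  rewrite (@big_cat_nat _ _ _ m) //=; last by lia.
  rewrite (@big_cat_nat _ _ _ (m + p).+1 m (m + n + p)) //=; [|by lia..].
  rewrite mulrA; congr (_ * _).
  rewrite [RHS]big_nat_rev -(add1n (m + p)) big_addn.
  have -> : (m + n + p - (m + p) = n)%N by lia.
  have bE i : (1 <= i < n)%N -> b (i + (m + p)) = b (1 + n - i.+1).
    by move=> i1n; rewrite -b_rev; [congr Defs.b; lia|lia].
  rewrite big_nat_cond [RHS]big_nat_cond; apply: eq_big => [i|i /andP[/bE -> _]] //.
  by case: (boolP (1 <= i < n)%N) => //= /bE ->.
have := prod_b_neq0 1 (m - 1); have := prod_b_neq0 1 (n - 1).
have := prod_b_neq0 1 (p - 1); rewrite E => Bp Bn Bm.
have N_gt0 : (0 < m * n * p)%N by rewrite !muln_gt0 m_gt0 n_gt0.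
have Nn0 : (m * n * p)%N%:R != 0 :> rat by rewrite pnatr_eq0 -lt0n.
have -> : ((m * n * p)`!)%:R = (m * n * p)%N%:R * ((m * n * p - 1)`!)%:R :> rat.
  by rewrite -natrM -[in LHS](prednK N_gt0) factS prednK // subn1.
move: Nn0; set N : rat := (_ * _ * _)%N%:R; move: N => N Nn0.
by field; rewrite Bp Nn0 Bn Bm.
Qed.

(** An expression symmetric in [m], [n], [p], which allows the reduction to minimal [p] to be made
    on numbers rather than on graphs. *)
Definition alternating_count : rat :=
  let a i := ((m - i) * (n - i) * (p - i))%N in
  - ((m * n * p)`!%:R * \sum_(0 <= k < (m * n * p).+1) (-1) ^+ k * k%:R
        * ((\prod_(i < k) a i)%:R / \prod_(1 <= i < k.+1) (a 0 - a i)%:R)).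

Lemma nb_successive_line_graph :
  (nb_successive_orderings (line_graph (K3 m n p)))%:R = alternating_count.
Proof.
have reg := @line_graph_fully_regular m n p.
pose a i := ((m - i) * (n - i) * (p - i))%N.
have cG := @fully_regular0 _ a reg; rewrite /a !subn0 in cG.
rewrite (@successive_fully_regular _ a _ reg) -?cG //.
by rewrite !muln_gt0 m_gt0 n_gt0.
Qed.

Hypotheses (p_le_m : (p <= m)%N) (p_le_n : (p <= n)%N).

(** As [p] is minimal, [i b_i] is [m n p] minus a product of factors that do not exceed [m], [n],
    [p], the last one being strictly smaller. *)
Lemma b_low_gt0 i : (1 <= i <= p)%N -> 0 < b i.
Proof.
move=> /andP[i1 ip]; rewrite -(@pmulr_rgt0 _ i%:Z) // mul_b.
have h1 : ((m - i) * (n - i) <= m * n)%N by rewrite leq_mul ?leq_subr.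
have h2 : ((m - i) * (n - i) * (p - i) < m * n * p)%N.
  apply: (@leq_ltn_trans (m * n * (p - i))); first by rewrite leq_mul.
  by rewrite ltn_pmul2l ?muln_gt0 ?m_gt0 //; lia.
have -> : (i%:Z - m%:Z) * (i%:Z - n%:Z) * (i%:Z - p%:Z)
    = - ((m - i) * (n - i) * (p - i))%N%:Z.
  by rewrite !PoszM -!subzn //; lia.
by rewrite subr_gt0 ltz_nat.
Qed.

(** In [mul_b] only [i - n] can be negative, and then the bounds [i - m <= p], [i - p <= m] and
    [n - i < n] keep the sum positive. *)
Lemma b_mid_gt0 i : (m <= i <= m + p)%N -> 0 < b i.
Proof.
move=> /andP[mi imp]; have i0 : (0 < i)%N by lia.
rewrite -(@pmulr_rgt0 _ i%:Z) // mul_b.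
have N_gt0 : (0 < m * n * p)%N by rewrite !muln_gt0 m_gt0 n_gt0.
have [ni|ilt] := leqP n i.
  rewrite ltr_pwDl ?ltz_nat // !mulr_ge0 ?subr_ge0 ?lez_nat //; lia.
have h1 : ((i - m) * (i - p) <= p * m)%N by rewrite leq_mul //; lia.
have h2 : ((i - m) * (i - p) * (n - i) < p * m * n)%N.
  apply: (@leq_ltn_trans (p * m * (n - i))); first by rewrite leq_mul.
  by rewrite ltn_pmul2l ?muln_gt0 ?m_gt0 ?p_gt0 //; lia.
have -> : (i%:Z - m%:Z) * (i%:Z - n%:Z) * (i%:Z - p%:Z)
    = - ((i - m) * (i - p) * (n - i))%N%:Z.
  by rewrite !PoszM -!subzn //; lia.
by rewrite subr_gt0 ltz_nat; lia.
Qed.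

Lemma sub_mul_b i : (i <= p)%N ->
  (m * n * p - (m - i) * (n - i) * (p - i))%N%:R = i%:R * (b i)%:~R :> rat.
Proof.
move=> ip.
have h : ((m - i) * (n - i) * (p - i) <= m * n * p)%N by rewrite !leq_mul ?leq_subr.
transitivity ((i%:Z * b i)%:~R : rat); last by rewrite rmorphM /= -pmulrn.
rewrite mul_b pmulrn; congr (_%:~R).
by rewrite -subzn // !PoszM -!subzn //; lia.
Qed.

Lemma alternating_countE :
  alternating_count = ((m * n * p)`!)%:R
      * (B m (m + p)%N / ((m * n * p)%N%:R * B 1%N (p - 1)%N)).
Proof.
rewrite /alternating_count /= !subn0 -mulrN; congr (_ * _).
rewrite (@big_cat_nat _ _ _ p.+1) //=; last first.
  by rewrite ltnS leq_pmull // muln_gt0 m_gt0.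
(* For [k] beyond [p] the product of the [a i] contains [a p = 0]. *)
rewrite [X in _ + X]big_nat_cond [X in _ + X]big1 ?addr0; last first.
  move=> k; rewrite andbT => /andP[pk _].
  by rewrite (bigD1 (Ordinal pk)) //= subnn muln0 mul0n mul0r mulr0.
have nz i : (1 <= i <= p)%N -> (b i)%:~R != 0 :> rat.
  by move=> /b_low_gt0 b0; rewrite intr_eq0 gt_eqF.
pose P : rat := \prod_(1 <= i < p.+1) (b i)%:~R.
have P0 : P != 0.
  rewrite prodf_seq_neq0; apply/allP => i; rewrite mem_index_iota ltnS => ip.
  by rewrite nz.
(* Everything is put over the common denominator [P]; the factorial left by [a 0 - a i = i b_i]
   cancels the one in [p ^_ k = 'C(p, k) * k!]. *)
have -> : \sum_(0 <= k < p.+1) (-1) ^+ k * k%:R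
    * ((\prod_(i < k) ((m - i) * (n - i) * (p - i)))%N%:R
       / \prod_(1 <= i < k.+1) (m * n * p - (m - i) * (n - i) * (p - i))%N%:R)
  = (\sum_(0 <= k < p.+1) (-1) ^+ k * k%:R * ('C(p, k) * m ^_ k * n ^_ k)%:R
      * \prod_(k.+1 <= i < p.+1) (b i)%:~R) / P.
  rewrite mulr_suml; apply: eq_big_nat => k; rewrite /= ltnS => kp.
  rewrite !big_split /= -!ffact_prod -(bin_ffact p).
  have -> : \prod_(1 <= i < k.+1) (m * n * p - (m - i) * (n - i) * (p - i))%N%:R
     = k`!%:R * \prod_(1 <= i < k.+1) (b i)%:~R :> rat.
    rewrite fact_prod natr_prod -big_split /=; apply: eq_big_nat => i /andP[_ ik].
    by rewrite sub_mul_b //; lia.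
  rewrite /P (@big_cat_nat _ _ _ k.+1 1 p.+1) //=.
  have Q1 : \prod_(1 <= i < k.+1) (b i)%:~R != 0 :> rat.
    rewrite prodf_seq_neq0; apply/allP => i; rewrite mem_index_iota ltnS => ik.
    by rewrite nz //; lia.
  have Q2 : \prod_(k.+1 <= i < p.+1) (b i)%:~R != 0 :> rat.
    rewrite prodf_seq_neq0; apply/allP => i; rewrite mem_index_iota ltnS => ik.
    by rewrite nz //; lia.
  have k0 : k`!%:R != 0 :> rat by rewrite pnatr_eq0 -lt0n fact_gt0.
  rewrite !natrM; move: Q1 Q2 k0; set x := \prod_(1 <= i < k.+1) _.
  set y := \prod_(_ <= i < _) _; set z := k`!%:R; move: x y z => x y z x0 y0 z0.
  by field; rewrite x0 y0 z0.
have /(congr1 (fun x : int => x%:~R : rat)) := @alternating_sum_b m n p p_gt0.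
rewrite rmorphM rmorphN rmorph_prod rmorph_sum rmorph_nat /=.
rewrite (eq_bigr (fun k => (-1) ^+ k * k%:R * ('C(p, k) * m ^_ k * n ^_ k)%:R
      * \prod_(k.+1 <= i < p.+1) (b i)%:~R)); last first.
  by move=> k _; rewrite !rmorphM rmorph_prod rmorph_sign !rmorph_nat ?natrM.
set X := \sum_(_ <= k < _) _ => XE.
(* For minimal [p] both ranges consist of positive [b i], so [prod_b] skips no factor. *)
rewrite (@prod_bE m) => [|i /b_mid_gt0 /gt_eqF -> //].
rewrite (@prod_bE 1) => [|i ip]; last by rewrite gt_eqF // b_low_gt0 //; lia.
rewrite -[\prod_(m <= i < _) _]opprK -XE.
(* The last factor is [b p = m n]; with the [p] of [alternating_sum_b] it makes up the [m n p] of
   the denominator. *)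
have PE : P = \prod_(1 <= i < (p - 1).+1) (b i)%:~R * (m * n)%:R.
  rewrite subn1 prednK // /P big_nat_recr //=; congr (_ * _).
  rewrite /Defs.b pmulrn; congr (_%:~R); rewrite PoszM; ring.
move: P0; rewrite PE !natrM; set Y := \prod_(_ <= i < _) _.
rewrite !mulf_eq0 !negb_or => /and3P[Y0 mz nz'].
have pz : p%:R != 0 :> rat by rewrite pnatr_eq0 -lt0n.
by field; rewrite Y0 mz nz' pz.
Qed.

End ClosedForm.

(** * Symmetry in the three class sizes *)

Lemma b_swap12 m n p : b m n p =1 b n m p.
Proof. by move=> i; rewrite /b; ring. Qed.

Lemma b_swap23 m n p : b m n p =1 b m p n.
Proof. by move=> i; rewrite /b; ring. Qed.

Lemma prod_b_swap12 m n p lo hi : prod_b m n p lo hi = prod_b n m p lo hi.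
Proof. by apply: eq_big => i; rewrite b_swap12. Qed.

Lemma prod_b_swap23 m n p lo hi : prod_b m n p lo hi = prod_b m p n lo hi.
Proof. by apply: eq_big => i; rewrite b_swap23. Qed.

Lemma alternating_count_swap12 m n p :
  alternating_count m n p = alternating_count n m p.
Proof.
rewrite /alternating_count (mulnC n m) /=; congr (- (_ * _)).
apply: eq_bigr => k _; congr (_ * (_%:R / _)); apply: eq_bigr => i _;
  by rewrite (mulnC (n - i)%N) ?(mulnC (n - 0)%N).
Qed.

Lemma alternating_count_swap23 m n p :
  alternating_count m n p = alternating_count m p n.
Proof.
rewrite /alternating_count (mulnAC m p n) /=; congr (- (_ * _)).
apply: eq_bigr => k _; congr (_ * (_%:R / _)); apply: eq_bigr => i _;
  by rewrite (mulnAC _ (p - i)%N) ?(mulnAC _ (p - 0)%N).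
Qed.

Definition closed_form m n p : rat :=
  ((m * n * p - 1)`!)%:R * prod_b m n p 1%N (m + n + p - 1)%N
    / (prod_b m n p 1%N (m - 1)%N * prod_b m n p 1%N (n - 1)%N
       * prod_b m n p 1%N (p - 1)%N).

Lemma closed_form_swap12 m n p : closed_form m n p = closed_form n m p.
Proof.
rewrite /closed_form !(prod_b_swap12 m) (mulnC n m) (addnC n m).
by congr (_ / _); ring.
Qed.

Lemma closed_form_swap23 m n p : closed_form m n p = closed_form m p n.
Proof.
rewrite /closed_form !(prod_b_swap23 m n) (mulnAC m p n) (addnAC m p n).
by congr (_ / _); ring.
Qed.

(** The second closed form is evaluated with the smallest size last, then turned into the first,
    whose visible symmetry transports the result to every order of the sizes. *)
Lemma alternating_count_closed_form m n p : (0 < m)%N -> (0 < n)%N -> (0 < p)%N ->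
  alternating_count m n p = closed_form m n p.
Proof.
have key q r s : (0 < q)%N -> (0 < r)%N -> (0 < s)%N -> (s <= q)%N -> (s <= r)%N ->
    alternating_count q r s = closed_form q r s.
  by move=> *; rewrite alternating_countE // -closed_forms_eq.
move=> m0 n0 p0; have [pm|mp] := leqP p m; have [pn|np] := leqP p n.
- exact: key.
- by rewrite alternating_count_swap23 closed_form_swap23 key //; lia.
- rewrite alternating_count_swap12 closed_form_swap12.
  by rewrite alternating_count_swap23 closed_form_swap23 key //; lia.
- have [mn|nm] := leqP m n.
    rewrite alternating_count_swap12 closed_form_swap12.
    by rewrite alternating_count_swap23 closed_form_swap23 key //; lia.
  by rewrite alternating_count_swap23 closed_form_swap23 key //; lia.
Qed.

Theorem theorem4 (m n p : nat) (hm : (0 < m)%N) (hn : (0 < n)%N)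
    (hp : (0 < p)%N) :
  let G := line_graph (K3 m n p) in
  let B := prod_b m n p in
  (nb_successive_orderings G)%:R
    = ((m * n * p - 1)`!)%:R * B 1%N (m + n + p - 1)%N
      / (B 1%N (m - 1)%N * B 1%N (n - 1)%N * B 1%N (p - 1)%N)
  /\
  ((m * n * p - 1)`!)%:R * B 1%N (m + n + p - 1)%N
      / (B 1%N (m - 1)%N * B 1%N (n - 1)%N * B 1%N (p - 1)%N)
    = ((m * n * p)`!)%:R
      * (B m (m + p)%N / ((m * n * p)%N%:R * B 1%N (p - 1)%N)).
Proof.
split; last exact: closed_forms_eq.
by rewrite nb_successive_line_graph // alternating_count_closed_form.
Qed.
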